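(* Let $j\ge1$ (and $2j-1\not\equiv0\pmod{2n+1}$ in the A-type case). Let $\gamma_0\in\mathcal{M}_{n+1,n}$ have rapidly decaying isotropic curvature $u_0$, and let $g_0:\mathbb{R}\to O(n+1,n)$ be the isotropic moving frame along $\gamma_0$. Let $u(x,t)$ be the solution of the $(2j-1)$-th $\hat B_n^{(1)}$-KdV flow $u_t=[\partial_x+b+u,P_{2j-1,0}(u)-\eta_j(u)]$ (respectively the $(2j-1)$-th $\hat A_{2n}^{(2)}$-KdV flow $u_t=[\partial_x+b+u,S_{2j-1,0}(u)-\tilde\eta_j(u)]$) with initial data $u(x,0)=u_0(x)$, and let $g$ be the $O(n+1,n)$-valued solution of $$g^{-1}g_x=b+u,\qquad g^{-1}g_t=P_{2j-1,0}(u)-\eta_j(u)\quad(\text{respectively } g^{-1}g_t=S_{2j-1,0}(u)-\tilde\eta_j(u))$$ with $g(0,0)=g_0(0)$. Then $\gamma(x,t)=g(x,t)e_1$ is a solution of the $(2j-1)$-th isotropic curve flow of B-type $\gamma_t=g(P_{2j-1,0}(u)-\eta_j(u))e_1=gP_{2j-1,0}(u)e_1$ (respectively of A-type $\gamma_t=g(S_{2j-1,0}(u)-\tilde\eta_j(u))e_1=gS_{2j-1,0}(u)e_1$) with $\gamma(x,0)=\gamma_0(x)$, and $\gamma(\cdot,t)$ has rapidly decaying isotropic curvatures.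
   Context: Let $n\ge 1$, let $e_{i,j}$ be the $(2n+1)\times(2n+1)$ elementary matrices, $C_n=\sum_{i=1}^{2n+1}(-1)^{n+i-1}e_{i,2n+2-i}$, $\mathbb{R}^{n+1,n}=\mathbb{R}^{2n+1}$ with $\langle X,Y\rangle=X^tC_nY$, $O(n+1,n)=\{A: A^tC_nA=C_n\}$ with Lie algebra $o(n+1,n)$, $\mathcal{N}_n^+$ the strictly upper triangular matrices in $o(n+1,n)$, and $e_1=(1,0,\dots,0)^t$. Put $b=\sum_{i=1}^{2n}e_{i+1,i}$, $\beta_i=e_{n+1-i,n+i}+e_{n+2-i,n+1+i}$, $V_n=\bigoplus_{i=1}^n\mathbb{R}\beta_i$. For matrix functions, $[\partial_x+A,B]=B_x+[A,B]$. ''Rapidly decaying'' refers to decay as $|x|\to\infty$. Curves. A smooth $\gamma:\mathbb{R}\to\mathbb{R}^{n+1,n}$ is isotropic if $\gamma,\gamma_s,\dots,\gamma_s^{(2n)}$ are linearly independent and $\gamma,\dots,\gamma_s^{(n-1)}$ span a maximal isotropic subspace (a maximal subspace on which $\langle\ ,\ \rangle$ vanishes) for every $s$. $\mathcal{M}_{n+1,n}$ is the set of isotropic curves with $\langle\gamma_x^{(n)},\gamma_x^{(n)}\rangle\equiv1$. The isotropic moving frame of $\gamma\in\mathcal{M}_{n+1,n}$ is the unique smooth $g:\mathbb{R}\to O(n+1,n)$ whose $i$-th column is $\gamma_x^{(i-1)}$ for $1\le i\le n+1$ and with $u=g^{-1}g_x-b\in C^\infty(\mathbb{R},V_n)$;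 $u=\sum_{i=1}^n u_i\beta_i$ is the isotropic curvature and $u_1,\dots,u_n$ are the isotropic curvatures of $\gamma$. In the curve flow equations, $g(\cdot,t)$ and $u(\cdot,t)$ are the isotropic moving frame and isotropic curvature along $\gamma(\cdot,t)\in\mathcal{M}_{n+1,n}$. B-type. $\hat B_n^{(1)}$ is the algebra of formal series $\sum_{i\le m_0}\xi_i\lambda^i$, $\xi_i\in o(n+1,n)$. Let $\beta=\frac12(e_{1,2n}+e_{2,2n+1})$, $J_B=b+\beta\lambda$; then $J_B^{2n+1}=\lambda J_B$. For $u\in C^\infty(\mathbb{R},V_n)$, $P(u,\lambda)$ is the unique $\hat B_n^{(1)}$-valued function of $x$ with $[\partial_x+J_B+u,P(u,\lambda)]=0$ that is conjugate to $J_B$ (in particular $P^{2n+1}=\lambda P$) and has leading term $J_B$, i.e. $P-J_B$ contains only terms of degree $\le0$ when $e_{i,j}\lambda^k$ has degree $i-j+2nk$. Write $P^{2j-1}(u,\lambda)=\sum_iP_{2j-1,i}(u)\lambda^i$. $\eta_j(u)\in C^\infty(\mathbb{R},\mathcal{N}_n^+)$ is the unique differential polynomial in $u$ with $[\partial_x+b+u,P_{2j-1,0}(u)-\eta_j(u)]\in C^\infty(\mathbb{R},V_n)$. A-type. $\hat A_{2n}^{(2)}$ is the algebra of formal series $\xi(\lambda)=\sum_{i\le m_0}\xi_i\lambda^i$, $\xi_i\in sl(2n+1,\mathbb{R})$, with $C_n\xi(-\lambda)^tC_n+\xi(\lambda)=0$. Let $J=b+e_{1,2n+1}\lambda$; then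 $J^{2n+1}=\lambda I$. $S(u,\lambda)$ is the unique $\hat A_{2n}^{(2)}$-valued function of $x$ with $[\partial_x+J+u,S(u,\lambda)]=0$ that is conjugate to $J$ (in particular $S^{2n+1}=\lambda I$) and has leading term $J$, i.e. $S-J$ contains only terms of degree $\le0$ when $e_{i,j}\lambda^k$ has degree $i-j+(2n+1)k$. Write $S^{2j-1}(u,\lambda)=\sum_iS_{2j-1,i}(u)\lambda^i$. $\tilde\eta_j(u)\in C^\infty(\mathbb{R},\mathcal{N}_n^+)$ is the unique differential polynomial in $u$ with $[\partial_x+b+u,S_{2j-1,0}(u)-\tilde\eta_j(u)]\in C^\infty(\mathbb{R},V_n)$. All $P_{2j-1,i}(u)$, $S_{2j-1,i}(u)$ are differential polynomials in $u$. *)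

(* Defs.v *)
From HB Require Import structures.
From mathcomp Require Import all_boot all_order all_algebra.
From mathcomp Require Import all_classical all_reals all_analysis.

Set Implicit Arguments.
Unset Strict Implicit.
Unset Printing Implicit Defensive.

Import Order.TTheory GRing.Theory Num.Theory.
Import numFieldNormedType.Exports.

Local Open Scope ring_scope.
Local Open Scope classical_set_scope.

Section Smoothness.
Context {R : realType} {V : normedModType R}.

Definition smooth (f : R -> V) : Prop :=
  forall (k : nat) (x : R), derivable (derive1n k f) x 1.

(* f x t is a function of the space variable x and the time t. *)
Definition dx (f : R -> R -> V) : R -> R -> V :=
  fun x t => derive1 (fun y => f y t) x.

Definition dt (f : R -> R -> V) : R -> R -> V :=
  fun x t => derive1 (f x) t.

(* Used for open sets of times I only, so that dx and dt at a point of R x I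
   depend only on the values of f on R x I. *)
Fixpoint Ck_on (I : set R) (k : nat) (f : R -> R -> V) : Prop :=
  (forall x t, I t -> {for (x, t), continuous (fun p : R * R => f p.1 p.2)}) /\
  match k with
  | 0%N => True
  | k'.+1 =>
      [/\ forall x t, I t ->
            derivable (fun y => f y t) x 1 /\ derivable (f x) t 1,
          Ck_on I k' (dx f)
        & Ck_on I k' (dt f)]
  end.

Definition smooth_on (I : set R) (f : R -> R -> V) : Prop :=
  forall k, Ck_on I k f.

(* Schwartz decay: every derivative is O(|x|^-p) as |x| -> oo, for all p. *)
Definition rapidly_decaying (f : R -> V) : Prop :=
  forall p k : nat, exists M : R, forall x : R, `|x| ^+ p * `|derive1n k f x| <= M.

End Smoothness.

Section Geometry.
Context {R : realType}.
Variable n : nat.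

Local Notation N := (n.*2.+1).

(* The elementary matrix e_{i,j}, with indices 1 <= i, j <= 2n + 1. *)
Definition elt (i j : nat) : 'M[R]_N := delta_mx (inord i.-1) (inord j.-1).

Definition Cmx : 'M[R]_N :=
  \sum_(1 <= i < N.+1) (-1) ^+ (n + i - 1) *: elt i (n.*2 + 2 - i).

Definition bmx : 'M[R]_N := \sum_(1 <= i < N) elt i.+1 i.

Definition beta (i : nat) : 'M[R]_N :=
  elt (n + 1 - i) (n + i) + elt (n + 2 - i) (n + 1 + i).

(* V_n is identified with R^n: the row (u_1, ..., u_n) stands for
   \sum_i u_i beta_i. *)
Definition Vmx (u : 'rV[R]_n) : 'M[R]_N := \sum_(i < n) u 0 i *: beta i.+1.

Definition e1 : 'cV[R]_N := delta_mx 0 0.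

Definition form (X Y : 'cV[R]_N) : R := (X^T *m Cmx *m Y) 0 0.

Definition in_O (A : 'M[R]_N) : Prop := A^T *m Cmx *m A = Cmx.

Definition in_o (A : 'M[R]_N) : Prop := A^T *m Cmx + Cmx *m A = 0.

Definition in_Nplus (A : 'M[R]_N) : Prop :=
  in_o A /\ forall i j : 'I_N, (j <= i)%N -> A i j = 0.

Definition totally_isotropic (U : {vspace 'cV[R]_N}) : Prop :=
  forall X Y, X \in U -> Y \in U -> form X Y = 0.

Definition maximal_isotropic (U : {vspace 'cV[R]_N}) : Prop :=
  totally_isotropic U /\
  forall W : {vspace 'cV[R]_N}, totally_isotropic W -> (U <= W)%VS -> W = U.

Definition jet (m : nat) (gamma : R -> 'cV[R]_N) (s : R) : seq 'cV[R]_N :=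
  [seq derive1n k gamma s | k <- iota 0 m].

Definition isotropic_curve (gamma : R -> 'cV[R]_N) : Prop :=
  smooth gamma /\
  forall s, free (jet N gamma s) /\ maximal_isotropic <<jet n gamma s>>%VS.

Definition in_Mcurves (gamma : R -> 'cV[R]_N) : Prop :=
  isotropic_curve gamma /\
  forall x, form (derive1n n gamma x) (derive1n n gamma x) = 1.

(* g is the isotropic moving frame and u the isotropic curvature along gamma;
   column i of g (numbered from 0) is the i-th derivative for 0 <= i <= n. *)
Definition moving_frame (gamma : R -> 'cV[R]_N) (g : R -> 'M[R]_N)
    (u : R -> 'rV[R]_n) : Prop :=
  [/\ smooth g,
      forall x, in_O (g x),
      forall x (i : 'I_N), (i <= n)%N -> col i (g x) = derive1n i gamma x,
      smooth u
    & forall x, invmx (g x) *m derive1 g x - bmx = Vmx (u x)].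

Definition isotropic_curvature (gamma : R -> 'cV[R]_N)
    (u : R -> 'rV[R]_n) : Prop := exists g, moving_frame gamma g u.

(* [d/dx + b + u, B] *)
Definition covd (u : R -> 'rV[R]_n) (B : R -> 'M[R]_N) (x : R) : 'M[R]_N :=
  derive1 B x + ((bmx + Vmx (u x)) *m B x - B x *m (bmx + Vmx (u x))).

End Geometry.

Section FormalSeries.
Context {R : realType}.
Variable N : nat.

(* The formal series \sum_i xi_i lambda^i is its family of coefficients xi. *)
Definition lseries := int -> 'M[R]_N.

Definition lbounded (A : lseries) : Prop :=
  exists m0 : int, forall i : int, m0 < i -> A i = 0.

(* For series satisfying lbounded the sum has finitely many nonzero terms. *)
Definition lmul (A B : lseries) : lseries :=
  fun k => \sum_(i \in [set: int]) (A i *m B (k - i)).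

Definition lone : lseries := fun k => if k == 0 then 1%:M else 0.

Definition lexp (A : lseries) (m : nat) : lseries := iter m (lmul A) lone.

Definition lconjugate (A B : lseries) : Prop :=
  exists T T' : lseries,
    [/\ lbounded T, lbounded T', lmul T T' = lone, lmul T' T = lone
      & B = lmul (lmul T A) T'].

End FormalSeries.

(* The two affine types: B for B_n^(1), A for A_2n^(2). *)
Variant kdv_type := Btype | Atype.

Section Flows.
Context {R : realType}.
Variables (ty : kdv_type) (n : nat).

Local Notation N := (n.*2.+1).

Definition loop_algebra (xi : @lseries R N) : Prop :=
  lbounded xi /\
  match ty with
  | Btype => forall i, in_o (xi i)
  | Atype => forall i, \tr (xi i) = 0 /\
      ((-1 : R) ^ i) *: (Cmx n *m (xi i)^T *m Cmx n) + xi i = 0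
  end.

(* The coefficient of lambda in J_B (type B) or J (type A); the constant
   coefficient is b in both cases. *)
Definition J1 : 'M[R]_N :=
  match ty with
  | Btype => 2^-1 *: (elt n 1 n.*2 + elt n 2 N)
  | Atype => elt n 1 N
  end.

(* The series J + u; J_B and J are the case u = 0. *)
Definition Jser (u : 'rV[R]_n) : lseries N := fun k =>
  if k == 0 then bmx n + Vmx u else if k == 1 then J1 else 0.

(* e_{i,j} lambda^k has degree i - j + lambda_degree * k. *)
Definition lambda_degree : nat :=
  match ty with Btype => n.*2 | Atype => N end.

(* An operator u |-> Q(u, lambda), resp. u |-> Q(u). *)
Definition series_operator := (R -> 'rV[R]_n) -> R -> @lseries R N.
Definition matrix_operator := (R -> 'rV[R]_n) -> R -> 'M[R]_N.

(* Q is u |-> P(u, lambda) for type B and u |-> S(u, lambda) for type A.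
   Conjugacy is taken pointwise in x, in the group of invertible
   gl(2n+1)-valued series; it forces Q^(2n+1) = lambda Q, resp.
   Q^(2n+1) = lambda, which already makes Q unique given the other clauses. *)
Definition is_resolvent (Q : series_operator) : Prop :=
  forall u : R -> 'rV[R]_n, smooth u ->
  [/\ forall k, smooth (fun x => Q u x k),
      forall x, loop_algebra (Q u x),
      forall x k, derive1 (fun y => Q u y k) x
        + (lmul (Jser (u x)) (Q u x) k - lmul (Q u x) (Jser (u x)) k) = 0,
      forall x, lconjugate (Jser 0) (Q u x)
    & forall x k (i j : 'I_N), (Q u x k - Jser 0 k) i j != 0 ->
        i%:Z - j%:Z + lambda_degree%:Z * k <= 0].

(* Scalar differential polynomials in u_1, ..., u_n. *)
Inductive diff_poly : ((R -> 'rV[R]_n) -> R -> R) -> Prop :=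
  | diff_poly_const (c : R) : diff_poly (fun _ _ => c)
  | diff_poly_jet (i : 'I_n) (k : nat) :
      diff_poly (fun u x => derive1n k (fun y => u y 0 i) x)
  | diff_poly_add F G : diff_poly F -> diff_poly G ->
      diff_poly (fun u x => F u x + G u x)
  | diff_poly_mul F G : diff_poly F -> diff_poly G ->
      diff_poly (fun u x => F u x * G u x).

Definition is_diff_poly_mx (F : matrix_operator) : Prop :=
  forall i k, exists2 f, diff_poly f &
    forall u, smooth u -> forall x, F u x i k = f u x.

(* The coefficient P_{2j-1,0}(u), resp. S_{2j-1,0}(u). *)
Definition lambda0_coef (j : nat) (Q : series_operator) : matrix_operator :=
  fun u x => lexp (Q u x) (j.*2.-1) 0.

Definition flow_operator (j : nat) (Q : series_operator)
    (eta : matrix_operator) : matrix_operator :=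
  fun u x => lambda0_coef j Q u x - eta u x.

(* eta is u |-> eta_j(u) for type B and u |-> tilde eta_j(u) for type A. *)
Definition is_eta (j : nat) (Q : series_operator) (eta : matrix_operator)
    : Prop :=
  is_diff_poly_mx eta /\
  forall u, smooth u ->
    (forall x, in_Nplus (eta u x)) /\
    exists2 v : R -> 'rV[R]_n, smooth v &
      forall x, covd u (flow_operator j Q eta u) x = Vmx (v x).

(* Solutions, on a time interval I, of u_t = [d/dx + b + u, F(u)] in the class
   of functions that are rapidly decaying in x at each time. *)
Definition kdv_solution (F : matrix_operator) (I : set R)
    (u : R -> R -> 'rV[R]_n) : Prop :=
  [/\ smooth_on I u,
      forall t, I t -> rapidly_decaying (fun x => u x t)
    & forall x t, I t ->
        Vmx (dt u x t) = covd (fun y => u y t) (F (fun y => u y t)) x].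

(* gamma solves gamma_t = g F(u) e_1, where g(., t) and u(., t) are the
   isotropic moving frame and the isotropic curvature along gamma(., t). *)
Definition curve_flow_solution (F : matrix_operator) (I : set R)
    (gamma : R -> R -> 'cV[R]_N) (g : R -> R -> 'M[R]_N)
    (u : R -> R -> 'rV[R]_n) : Prop :=
  [/\ smooth_on I gamma,
      forall t, I t -> in_Mcurves (fun x => gamma x t),
      forall t, I t ->
        moving_frame (fun x => gamma x t) (fun x => g x t) (fun x => u x t)
    & forall x t, I t ->
        dt gamma x t = g x t *m F (fun y => u y t) x *m e1 n].

End Flows.

(* Main.v *)
Require Import Defs.
From mathcomp Require Import all_boot all_order all_algebra.
From mathcomp Require Import all_classical all_reals all_analysis.
From mathcomp Require Import zify ring.

Set Implicit Arguments.
Unset Strict Implicit.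
Unset Printing Implicit Defensive.

Import Order.TTheory GRing.Theory Num.Theory.
Import numFieldNormedType.Exports.

Local Open Scope ring_scope.
Local Open Scope classical_set_scope.

(** Write D = b + u, with u in V_n. For t in the time interval, g(., t) is an
    O(n+1,n)-valued solution of g_x = g D (the predicate frame_system below),
    and everything reduces to facts about such solutions.

    - D maps e_k to e_(k+1) for k <= n, so the derivatives of gamma = g e_1 up
      to order n are the first n+1 columns of g (derive1n_frame). All
      derivatives satisfy gamma^(k) = g w_k, where w_(k+1) = w_k' + D w_k; as
      D is b plus a strictly upper triangular matrix, w_k equals e_(k+1) plus a
      combination of e_1, ..., e_k (jet_frame_unitriangular), so the first
      2n+1 of them are independent. Since g preserves the form, the span of
      the first n columns is maximal isotropic because the span of e_1, ..., e_n
      is (maximal_isotropic_frame), and the next column has norm 1. Hence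
      gamma(., t) is in M_{n+1,n}, with frame g and curvature u.

    - gamma_t = g_t e_1 = g (P - eta) e_1 by the time equation, and eta e_1 = 0
      because eta is strictly upper triangular.

    - g(., 0) and g_0 solve the same linear equation with the same value at 0,
      and a quotient g h^-1 of two solutions is constant since D lies in the Lie
      algebra o(n+1,n) (frame_system_unique); so gamma(., 0) = gamma_0.

    - Isotropic curvature is determined by the curve
      (isotropic_curvature_unique), so the curvatures of gamma(., t) are
      those of u(., t), which decays rapidly because u is taken in that class.
      *)

Local Ltac ord_lia :=
  repeat match goal with
  | i : ordinal ?m |- _ =>
      lazymatch goal with
      | _ : is_true (leq (S (nat_of_ord i)) m) |- _ => fail
      | _ => have ? : (i < m)%N by exact: ltn_ord
      end
  end; lia.

(** * Derivatives of matrix-valued functions *)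

Section MatrixCalculus.
Context {R : realType}.

Lemma is_derive_mx (m n : nat) (A : R -> 'M[R]_(m.+1, n.+1)) (x : R)
    (dA : 'M[R]_(m.+1, n.+1)) :
  (forall i j, is_derive x 1 (fun y => A y i j) (dA i j)) -> is_derive x 1 A dA.
Proof.
move=> h; have dAx : derivable A x 1.
  by apply/derivable_mxP => i j; have [] := h i j.
apply: DeriveDef => //; rewrite derive_mx//; apply/matrixP => i j.
by rewrite mxE; have [_ ->] := h i j.
Qed.

Lemma is_derive_entry (m n : nat) (A : R -> 'M[R]_(m.+1, n.+1)) (x : R) i j :
  derivable A x 1 -> is_derive x 1 (fun y => A y i j) (derive1 A x i j).
Proof.
move=> dA; rewrite derive1E derive_mx// mxE; apply: derivableP.
exact: (derivable_mxP _ _ _).1.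
Qed.

Lemma derivable_derive1 (V : normedModType R) (f : R -> V) (x : R) df :
  is_derive x 1 f df -> derivable f x 1 /\ derive1 f x = df.
Proof. by move=> [? <-]; rewrite derive1E. Qed.

Lemma is_derive_mulmx (m n p : nat) (A : R -> 'M[R]_(m.+1, n.+1))
    (B : R -> 'M[R]_(n.+1, p.+1)) (x : R) :
  derivable A x 1 -> derivable B x 1 ->
  is_derive x 1 (fun y => A y *m B y) (derive1 A x *m B x + A x *m derive1 B x).
Proof.
move=> dA dB; apply: is_derive_mx => i j.
have -> : (fun y => (A y *m B y) i j) =
    \sum_k (fun y => A y i k) * (fun y => B y k j).
  by apply/funext => y; rewrite mxE fct_sumE.
rewrite !mxE -big_split/=; apply: is_derive_sum => k.
apply: (is_derive_eq (is_deriveM (is_derive_entry i k dA)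
  (is_derive_entry k j dB))).
by rewrite [RHS]addrC; congr (_ + _); exact: mulrC.
Qed.

Lemma derivable_mulmx (m n p : nat) (A : R -> 'M[R]_(m.+1, n.+1))
    (B : R -> 'M[R]_(n.+1, p.+1)) (x : R) :
  derivable A x 1 -> derivable B x 1 -> derivable (fun y => A y *m B y) x 1.
Proof. by move=> dA dB; case: (is_derive_mulmx dA dB). Qed.

Lemma derive1_mulmx (m n p : nat) (A : R -> 'M[R]_(m.+1, n.+1))
    (B : R -> 'M[R]_(n.+1, p.+1)) (x : R) :
  derivable A x 1 -> derivable B x 1 ->
  derive1 (fun y => A y *m B y) x = derive1 A x *m B x + A x *m derive1 B x.
Proof.
by move=> dA dB; have [_ ->] := derivable_derive1 (is_derive_mulmx dA dB).
Qed.

Lemma is_derive_trmx (m n : nat) (A : R -> 'M[R]_(m.+1, n.+1)) (x : R) :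
  derivable A x 1 -> is_derive x 1 (fun y => (A y)^T) (derive1 A x)^T.
Proof.
move=> dA; apply: is_derive_mx => i j; rewrite mxE.
have -> : (fun y => (A y)^T i j) = (fun y => A y j i).
  by apply/funext => y; rewrite mxE.
exact: is_derive_entry.
Qed.

Lemma derive1_mulmx_cst (m n p : nat) (A : R -> 'M[R]_(m.+1, n.+1))
    (c : 'M[R]_(n.+1, p.+1)) (x : R) :
  derivable A x 1 ->
  derivable (fun y => A y *m c) x 1 /\
  derive1 (fun y => A y *m c) x = derive1 A x *m c.
Proof.
move=> dA; have dc : derivable (fun _ : R => c) x 1 by exact: derivable_cst.
split; first exact: (derivable_mulmx dA dc).
by rewrite (derive1_mulmx dA dc) derive1_cst mulmx0 addr0.
Qed.

Lemma derive1_eq0_cst (m n : nat) (A : R -> 'M[R]_(m.+1, n.+1)) :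
  (forall x, derivable A x 1) -> (forall x, derive1 A x = 0) ->
  forall x y, A x = A y.
Proof.
move=> dA A0 x y; apply/matrixP => i j.
apply: (is_derive_0_is_cst (f := fun z => A z i j)) => z.
by have := is_derive_entry i j (dA z); rewrite A0 mxE.
Qed.

(** Right multiplication is a finite combination of the entry functions, which
    are continuous. *)
Lemma continuous_mulmxr (m n p : nat) (c : 'M[R]_(n.+1, p.+1)) :
  continuous (fun A : 'M[R]_(m.+1, n.+1) => A *m c).
Proof.
have -> : (fun A : 'M[R]_(m.+1, n.+1) => A *m c) =
    fun A => \sum_i \sum_j A i j *: (delta_mx i j *m c).
  apply/funext => A; rewrite {1}(matrix_sum_delta A) mulmx_suml.
  apply: eq_bigr => i _; rewrite mulmx_suml; apply: eq_bigr => j _.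
  by rewrite scalemxAl.
have csum k (F : 'I_k -> 'M[R]_(m.+1, n.+1) -> 'M[R]_(m.+1, p.+1)) :
    (forall i, continuous (F i)) -> continuous (fun A => \sum_i F i A).
  move=> cF A; rewrite -fct_sumE.
  elim/big_rec : _ => [|i G _ cG]; last first.
    by apply: (@continuousD _ _ _ (F i) G A) => //; exact: cF.
  exact: (@cst_continuous 'M[R]_(m.+1, n.+1) 'M[R]_(m.+1, p.+1) 0 A).
apply: (csum _ (fun i A => \sum_j A i j *: (delta_mx i j *m c))) => i.
apply: (csum _ (fun j A => A i j *: (delta_mx i j *m c))) => j A.
exact: cvgZr_tmp (@coord_continuous R m.+1 n.+1 i j A).
Qed.

End MatrixCalculus.

(** * Smooth families on a time interval *)

Section SmoothFamilies.
Context {R : realType}.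
Implicit Types (I : set R).

(** Openness of I makes f and h agree near every point of R x I, so that their
    limits and their time derivatives agree there too. *)
Lemma Ck_on_eq (V : normedModType R) I k (f h : R -> R -> V) : open I ->
  (forall x t, I t -> f x t = h x t) -> Ck_on I k f -> Ck_on I k h.
Proof.
move=> oI; elim: k f h => [|k IH] f h fh [cf df].
all: have ch x t : I t ->
  {for (x, t), continuous (fun p : R * R => h p.1 p.2)}.
1,3: move=> It; have nI : \forall p \near (x, t), I p.2
    by apply: open_nbhs_nbhs; split => //;
      apply: (@open_comp _ _ snd) => // z _; exact: cvg_snd.
1,2: rewrite /prop_for /continuous_at -fh//;
  apply: cvg_trans _ (cf x t It); apply: near_eq_cvg;
  by near=> p; rewrite fh//; near: p.
  by split.
split=> //.
case: df => df dxf dtf.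
have eqx t : I t -> (fun y => f y t) = (fun y => h y t).
  by move=> It; apply/funext => y; exact: fh.
have eqt x t : I t -> \near t, f x t = h x t.
  move=> It; near=> s; apply: fh; near: s.
  by apply: open_nbhs_nbhs; split.
split.
- move=> x t It; have [dfx dft] := df x t It; split; first by rewrite -eqx.
  by move: dft; apply: near_eq_derivable; exact: eqt.
- by apply: IH dxf => x t It; rewrite /dx eqx.
- apply: IH dtf => x t It; rewrite /dt !derive1E.
  by apply: near_eq_derive; exact: eqt.
Unshelve. all: by end_near. Qed.

(** The derivatives of f c are those of f times c only on R x I, where f is
    known to be derivable; Ck_on_eq bridges the gap in the induction. *)
Lemma smooth_on_mulmxr (m n p : nat) I (f : R -> R -> 'M[R]_(m.+1, n.+1))
    (c : 'M[R]_(n.+1, p.+1)) : open I ->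
  smooth_on I f -> smooth_on I (fun x t => f x t *m c).
Proof.
move=> oI sf k; move: (sf k) => {sf}.
elim: k f => [|k IH] f [cf df]; split.
1,3: move=> x t It.
1,2: apply: (@continuous_comp _ _ _ (fun q : R * R => f q.1 q.2)
    (fun A => A *m c)); [exact: cf|exact: continuous_mulmxr].
  by [].
case: df => df dxf dtf; split.
- move=> x t It; have [dfx dft] := df x t It.
  by split; [have [] := derive1_mulmx_cst c dfx|
             have [] := derive1_mulmx_cst c dft].
- apply: (Ck_on_eq oI _ (IH _ dxf)) => x t It; have [dfx _] := df x t It.
  by rewrite /dx (derive1_mulmx_cst c dfx).2.
- apply: (Ck_on_eq oI _ (IH _ dtf)) => x t It; have [_ dft] := df x t It.
  by rewrite /dt (derive1_mulmx_cst c dft).2.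
Qed.

Lemma smooth_on_slice (V : normedModType R) I (f : R -> R -> V) t :
  smooth_on I f -> I t -> smooth (fun x => f x t).
Proof.
move=> sf It k.
have {sf} : smooth_on I (iter k dx f).
  by elim: k => //= k IH l; have [_ []] := IH l.+1.
have -> : derive1n k (fun x => f x t) = (fun x => iter k dx f x t).
  by elim: k => //= k ->.
by move=> /(_ 1%N) [_ [df _ _]] x; have [] := df x t It.
Qed.

End SmoothFamilies.

(** * Entries of the structure matrices, and the form *)

Section MatrixEntries.
Context {R : realType} (n : nat).
Local Notation N := (n.*2.+1).
Local Notation form := Defs.form.

Lemma eltE i j (a c : 'I_N) : (0 < i <= N)%N -> (0 < j <= N)%N ->
  elt n i j a c = ((a.+1 == i) && (c.+1 == j))%:R :> R.
Proof.
move=> hi hj; rewrite mxE; congr (_ _ _).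
by rewrite -!val_eqE/= !inordK; ord_lia.
Qed.

(** Indices run from 0 here, so C_n pairs a with 2n - a, which is rev_ord a. *)
Lemma CmxE (a c : 'I_N) :
  Cmx n a c = (-1) ^+ (n + a) * (c == rev_ord a)%:R :> R.
Proof.
rewrite /Cmx big_add1/= big_mkord summxE (bigD1 a)//= big1 => [|i ia].
  rewrite mxE eltE; [|ord_lia|ord_lia].
  by rewrite eqxx addr0 -val_eqE/=; congr (_ ^+ _ * _ %:R); ord_lia.
rewrite mxE eltE; [|ord_lia|ord_lia].
by rewrite eqSS val_eqE eq_sym (negPf ia) mulr0.
Qed.

Lemma Cmx_sq : Cmx n *m Cmx n = 1%:M :> 'M[R]_N.
Proof.
apply/matrixP => a c; rewrite mxE (bigD1 (rev_ord a))//= big1 => [|k ka].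
  rewrite !CmxE eqxx mulr1 rev_ordK mxE addr0 eq_sym mulrA -exprD.
  by rewrite -signr_odd (_ : odd _ = false) ?mul1r//=; ord_lia.
by rewrite CmxE (negPf ka) mulr0 mul0r.
Qed.

Lemma formE (X Y : 'cV[R]_N) :
  form X Y = \sum_(a < N) (-1) ^+ (n + a) * (X a 0 * Y (rev_ord a) 0).
Proof.
rewrite /form -mulmxA mxE; apply: eq_bigr => a _; rewrite !mxE.
rewrite (bigD1 (rev_ord a))//= big1 => [|k ka]; rewrite CmxE.
  by rewrite eqxx mulr1 addr0; ring.
by rewrite (negPf ka) mulr0 mul0r.
Qed.

Lemma form_delta (i : 'I_N) (Y : 'cV[R]_N) :
  form (delta_mx i 0) Y = (-1) ^+ (n + i) * Y (rev_ord i) 0.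
Proof.
rewrite formE (bigD1 i)//= big1 ?addr0 => [|a ai]; rewrite mxE ?eqxx ?mul1r//.
by rewrite (negPf ai) mul0r mulr0.
Qed.

Lemma form_mulmx_in_O (A : 'M[R]_N) X Y :
  in_O A -> form (A *m X) (A *m Y) = form X Y.
Proof.
move=> OA; rewrite /form trmx_mul.
by rewrite -(mulmxA X^T) -(mulmxA X^T) (mulmxA _ A Y) OA mulmxA.
Qed.

Lemma in_O_inv (A : 'M[R]_N) : in_O A -> (Cmx n *m A^T *m Cmx n) *m A = 1%:M.
Proof. by move=> OA; rewrite -!mulmxA (mulmxA A^T) OA Cmx_sq. Qed.

Lemma in_O_unit (A : 'M[R]_N) : in_O A -> A \in unitmx.
Proof. by move=> /in_O_inv /mulmx1_unit[]. Qed.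

Lemma in_O_invmx (A : 'M[R]_N) : in_O A -> invmx A = Cmx n *m A^T *m Cmx n.
Proof.
move=> OA; rewrite -[LHS]mul1mx -(in_O_inv OA) -!mulmxA mulmxV ?mulmx1//.
exact: in_O_unit.
Qed.

Lemma bmxE (a c : 'I_N) : bmx n a c = (a == c.+1 :> nat)%:R :> R.
Proof.
rewrite /bmx big_add1/= big_mkord summxE.
rewrite (eq_bigr (fun i : 'I_n.*2 => ((a.+1 == i.+2) && (c.+1 == i.+1))%:R));
  last by move=> i _; have := ltn_ord i => ?; rewrite eltE//; lia.
have [cN|cN] := ltnP c n.*2.
  rewrite (bigD1 (Ordinal cN))//= big1 => [|i ic].
    by rewrite eqxx andbT addr0 eqSS.
  have -> : (c.+1 == i.+1) = false by move: ic; rewrite -val_eqE/=; ord_lia.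
  by rewrite andbF.
have -> : (a == c.+1 :> nat) = false by ord_lia.
apply: big1 => i _; have -> : (c.+1 == i.+1) = false by ord_lia.
by rewrite andbF.
Qed.

Lemma betaE (i : 'I_n) (a c : 'I_N) :
  beta n i.+1 a c = ((a + i.+1 == n) && (c == n + i :> nat))%N%:R
                  + ((a + i == n) && (c == n + i.+1 :> nat))%N%:R :> R.
Proof.
rewrite /beta mxE !eltE; [|ord_lia..].
by congr (_%:R + _%:R); ord_lia.
Qed.

Lemma VmxE (w : 'rV[R]_n) (a c : 'I_N) :
  Vmx w a c = \sum_(i < n) w 0 i * beta n i.+1 a c.
Proof. by rewrite summxE; apply: eq_bigr => i _; rewrite mxE. Qed.

Lemma Vmx_upper (w : 'rV[R]_n) (a c : 'I_N) : (c <= a)%N -> Vmx w a c = 0.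
Proof.
move=> ca; rewrite VmxE big1// => i _; rewrite betaE.
have -> : ((a + i.+1 == n) && (c == n + i :> nat))%N = false by ord_lia.
have -> : ((a + i == n) && (c == n + i.+1 :> nat))%N = false by ord_lia.
by rewrite addr0 mulr0.
Qed.

Lemma Vmx_left (w : 'rV[R]_n) (a c : 'I_N) : (c < n)%N -> Vmx w a c = 0.
Proof.
move=> ca; rewrite VmxE big1// => i _; rewrite betaE.
have -> : ((a + i.+1 == n) && (c == n + i :> nat))%N = false by ord_lia.
have -> : ((a + i == n) && (c == n + i.+1 :> nat))%N = false by ord_lia.
by rewrite addr0 mulr0.
Qed.

Lemma VmxB (v w : 'rV[R]_n) : Vmx (v - w) = Vmx v - Vmx w :> 'M[R]_N.
Proof.
rewrite /Vmx -sumrB; apply: eq_bigr => i _.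
by rewrite !mxE scalerBl.
Qed.

(** Column n+i (numbered from 0) of a matrix of V_n involves only the
    coordinates i and i-1; when the latter vanishes, a single entry survives,
    in the row paired by the form with the index n+i+1 of the next column. *)
Lemma Vmx_first (w : 'rV[R]_n) (i : 'I_n) (a c : 'I_N) :
  (forall k : 'I_n, (k < i)%N -> w 0 k = 0) -> c = (n + i)%N :> nat ->
  Vmx w a c = w 0 i * (a + i.+1 == n)%N%:R.
Proof.
move=> w0 ci; rewrite VmxE (bigD1 i)//= big1 => [|k ki]; rewrite betaE.
  have -> : ((a + i == n) && (c == n + i.+1 :> nat))%N = false by ord_lia.
  by rewrite !addr0; congr (_ * _%:R); ord_lia.
have [kli|] := ltnP k i; first by rewrite w0// mul0r.
move: ki; rewrite -val_eqE/= => ki ik.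
have -> : ((a + k.+1 == n) && (c == n + k :> nat))%N = false by ord_lia.
have -> : ((a + k == n) && (c == n + k.+1 :> nat))%N = false by ord_lia.
by rewrite addr0 mulr0.
Qed.

End MatrixEntries.

(** * Linear algebra of the columns of an isometry *)

Section IsotropicFlags.
Context {R : realType} (n : nat).
Local Notation N := (n.*2.+1).
Local Notation form := Defs.form.
Implicit Types A : 'M[R]_N.

(** The coordinates in the basis of columns of A are linear functionals, so
    they vanish on a span as soon as they do on its generators. *)
Lemma span_entry_eq0 A (w : nat -> 'cV[R]_N) (s : seq nat) (i : 'I_N) X :
  A \in unitmx -> (forall k, k \in s -> w k i 0 = 0) ->
  X \in <<[seq A *m w k | k <- s]>>%VS -> (invmx A *m X) i 0 = 0.
Proof.
move=> uA w0 /(@coord_span _ _ _ (in_tuple _)) ->.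
rewrite mulmx_sumr summxE big1// => k _; rewrite -scalemxAr mxE.
have ks : (k < size s)%N by rewrite -(size_map (fun k => A *m w k)) ltn_ord.
by rewrite /= (nth_map 0%N)//= mulKmx// w0 ?mulr0// mem_nth.
Qed.

(** By induction on m: coordinate m in the basis of columns of A kills the first
    m vectors but not the next one. *)
Lemma free_unitriangular A (w : nat -> 'cV[R]_N) (m : nat) :
  A \in unitmx -> (m <= N)%N ->
  (forall (k : nat) (i : 'I_N), (k < i)%N -> w k i 0 = 0) ->
  (forall i : 'I_N, w i i 0 = 1) ->
  free [seq A *m w k | k <- iota 0 m].
Proof.
move=> uA mN w0 w1; elim: m mN => [|m IH] mN; first exact: nil_free.
rewrite -(addn1 m) iotaD map_cat/= cats1 add0n.
rewrite (perm_free (permEl (perm_rcons _ _))).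
rewrite free_cons IH ?andbT//; last exact: ltnW.
apply/negP => /(span_entry_eq0 (i := Ordinal mN) uA) H.
have /eqP : (invmx A *m (A *m w m)) (Ordinal mN) 0 = 0.
  by apply: H => k; rewrite mem_iota => /andP[_ km]; apply: w0.
by rewrite mulKmx// (w1 (Ordinal mN)) oner_eq0.
Qed.

(** In the basis of columns of A the form has matrix C_n. If W is isotropic and
    contains the first n columns, pairing X in W with them kills the
    coordinates of X beyond the middle one n; then <X, X> = 0 reduces to the
    square of the middle coordinate, which vanishes too. *)
Lemma maximal_isotropic_frame A : in_O A ->
  maximal_isotropic <<[seq A *m delta_mx (inord k) 0%R | k <- iota 0 n]>>%VS.
Proof.
move=> OA; have uA := in_O_unit OA.
set U := <<_>>%VS.
have UP X : reflect (forall i : 'I_N, (n <= i)%N -> (invmx A *m X) i 0 = 0)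
    (X \in U).
  apply: (iffP idP) => [XU i ni|X0].
    apply: (span_entry_eq0 uA _ XU) => k; rewrite mem_iota => kn.
    rewrite mxE -val_eqE/= inordK; last by ord_lia.
    by rewrite (_ : _ == _ = false)//; ord_lia.
  rewrite -[X](mulKVmx uA); set Y := invmx A *m X in X0 *.
  rewrite (matrix_sum_delta Y) mulmx_sumr rpred_sum// => i _.
  rewrite big_ord1 -scalemxAr.
  have [ni|ni] := leqP n i.
    by have -> : Y i ord0 = 0 by [exact: X0]; rewrite scale0r mem0v.
  apply: rpredZ; apply: memv_span; apply/mapP; exists (i : nat).
    by rewrite mem_iota.
  by rewrite inord_val.
have formA X Y : form X Y = form (invmx A *m X) (invmx A *m Y).
  by rewrite -[RHS](form_mulmx_in_O _ _ OA) !mulKVmx.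
split=> [X Y /UP X0 /UP Y0|W Wiso UW].
  rewrite formA formE big1// => a _.
  have [na|na] := leqP n a; first by rewrite X0// mul0r mulr0.
  by rewrite Y0 ?mulr0//=; ord_lia.
apply/eqP; rewrite eqEsubv UW andbT; apply/subvP => X XW; apply/UP.
have Xhi (i : 'I_N) : (n < i)%N -> (invmx A *m X) i 0 = 0.
  move=> ni; have riU : A *m delta_mx (rev_ord i) 0 \in W.
    apply: (subvP UW); apply: memv_span; apply/mapP; exists (rev_ord i : nat).
      by rewrite mem_iota/=; ord_lia.
    by rewrite inord_val.
  have := Wiso _ _ riU XW; rewrite formA mulKmx// form_delta rev_ordK.
  by move/eqP; rewrite mulf_eq0 signr_eq0 => /eqP.
move=> i; rewrite leq_eqVlt => /orP[/eqP ni|]; last exact: Xhi.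
have := Wiso _ _ XW XW; rewrite formA formE (bigD1 i)//= big1 => [|a ai].
  have -> : rev_ord i = i by apply: val_inj => /=; ord_lia.
  by rewrite addr0 => /eqP; rewrite mulf_eq0 signr_eq0/= mulf_eq0 orbb => /eqP.
move: ai; rewrite -val_eqE/= => ai.
have [na|na] := ltnP n a; first by rewrite Xhi// mul0r mulr0.
by rewrite (Xhi (rev_ord a)) ?mulr0//=; ord_lia.
Qed.

End IsotropicFlags.

(** * Moving frames as solutions of a linear equation *)

Section Frames.
Context {R : realType} (n : nat).
Local Notation N := (n.*2.+1).
Local Notation form := Defs.form.
Implicit Types (g h : R -> 'M[R]_N) (u v : R -> 'rV[R]_n).

Definition frame_system g u := forall x,
  [/\ derivable g x 1, in_O (g x)
    & derive1 g x = g x *m (bmx n + Vmx (u x))].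

(** On O(n+1,n) inversion is the linear map A |-> C_n A^t C_n. *)
Lemma derivable_invmx_in_O g x : (forall y, in_O (g y)) -> derivable g x 1 ->
  derivable (fun y => invmx (g y)) x 1.
Proof.
move=> gO dg; under eq_fun => y do rewrite (in_O_invmx (gO y)).
have dC : derivable (fun=> Cmx n : 'M[R]_N) x 1 by exact: derivable_cst.
have [dgT _] := derivable_derive1 (is_derive_trmx dg).
exact: (derivable_mulmx (derivable_mulmx dC dgT) dC).
Qed.

(** Differentiate g^t C g = C and cancel g. *)
Lemma frame_system_in_o g u x : frame_system g u -> in_o (bmx n + Vmx (u x)).
Proof.
move=> gu; have [dg OG gx] := gu x; set D := _ + _ in gx *.
have [dgT gTx] := derivable_derive1 (is_derive_trmx dg).
have [dgTC gTCx] := derive1_mulmx_cst (Cmx n) dgT.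
have := derive1_mulmx dgTC dg.
rewrite (_ : (fun y => _) = fun=> Cmx n); last first.
  by apply/funext => y; have [] := gu y.
rewrite derive1_cst gTCx gTx gx trmx_mul !mulmxA => H.
by rewrite /in_o -[Cmx n]OG !mulmxA -H.
Qed.

(** K = g h^-1 = g C h^t C has derivative g (D C + C D^t) h^t C, and D C + C D^t
    vanishes because D lies in o(n+1,n) and C^2 = 1. *)
Lemma frame_system_unique g h u x0 : frame_system g u -> frame_system h u ->
  g x0 = h x0 -> forall x, g x = h x.
Proof.
move=> gu hu gh0 x.
have uh y : h y \in unitmx by apply: in_O_unit; have [] := hu y.
have hO y : in_O (h y) by have [] := hu y.
pose K y := g y *m (Cmx n *m (h y)^T *m Cmx n).
have KE y : K y = g y *m invmx (h y) by rewrite /K -in_O_invmx.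
suff K1 : K x = K x0.
  move: K1; rewrite !KE gh0 mulmxV// => K1.
  by rewrite -[LHS](mulmxKV (uh x)) K1 mul1mx.
have dK (y : R) : is_derive y 1 K 0.
  have [dg _ gy] := gu y; have [dh Oh hy] := hu y.
  have := frame_system_in_o y gu; rewrite /in_o.
  set D := bmx n + _ in gy hy *; move=> oD.
  have dC : derivable (fun=> Cmx n : 'M[R]_N) y 1 by exact: derivable_cst.
  have [dhT hTy] := derivable_derive1 (is_derive_trmx dh).
  have dChT := derivable_mulmx dC dhT.
  have ChTy := derive1_mulmx dC dhT.
  have [dChTC ChTCy] := derive1_mulmx_cst (Cmx n) dChT.
  apply: (is_derive_eq (is_derive_mulmx dg dChTC)).
  rewrite ChTCy ChTy derive1_cst mul0mx add0r gy hTy hy trmx_mul.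
  have CD : D *m Cmx n + Cmx n *m D^T = 0.
    transitivity (Cmx n *m (D^T *m Cmx n + Cmx n *m D) *m Cmx n).
      rewrite mulmxDr mulmxDl !mulmxA Cmx_sq mul1mx -!mulmxA Cmx_sq mulmx1.
      by rewrite addrC.
    by rewrite oD mulmx0 mul0mx.
  rewrite -!mulmxA -mulmxDr !mulmxA -!mulmxDl.
  by rewrite CD !mul0mx mulmx0.
apply: derive1_eq0_cst => y; first by case: (dK y).
by have [] := derivable_derive1 (dK y).
Qed.

Lemma frame_matrix_left (w : 'rV[R]_n) (c : nat) : (c < n)%N ->
  (bmx n + Vmx w) *m delta_mx (inord c) 0
  = delta_mx (inord c.+1) 0 :> 'cV[R]_N.
Proof.
move=> cn; rewrite -colE; apply/matrixP => a z.
rewrite !mxE ord1 bmxE Vmx_left ?addr0 ?andbT -?val_eqE/= ?inordK//; by lia.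
Qed.

Lemma derive1n_frame g u k : frame_system g u -> (k <= n)%N ->
  derive1n k (fun x => g x *m e1 n) = fun x => g x *m delta_mx (inord k) 0.
Proof.
move=> gu; elim: k => [|k IH] kn.
  apply/funext => x; congr (_ *m delta_mx _ _).
  by apply: val_inj; rewrite /= inordK.
rewrite derive1nS IH; last exact: ltnW.
apply/funext => x; have [dg _ gx] := gu x.
by rewrite (derive1_mulmx_cst _ dg).2 gx -mulmxA frame_matrix_left.
Qed.

(** With gamma = g w_0 and w_k = g^-1 gamma^(k), the equation for g gives
    w_(k+1) = w_k' + D w_k. The derivative w_k' loses the constant leading entry
    1 of w_k, while D = b + (strictly upper triangular) moves it one row
    down. Each w_k is derivable because gamma^(k) and g^-1 are. *)
Lemma jet_frame_unitriangular g u k :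
  frame_system g u -> smooth (fun x => g x *m e1 n) ->
  let w x := invmx (g x) *m derive1n k (fun x => g x *m e1 n) x in
  forall x (i : 'I_N), ((k < i)%N -> w x i 0 = 0) /\ (k = i -> w x i 0 = 1).
Proof.
move=> gu sg.
have ug x : g x \in unitmx by apply: in_O_unit; have [] := gu x.
elim: k => [|k IH] /= x i.
  rewrite mulKmx// mxE eqxx andbT -val_eqE/=.
  by split; [case: (i : nat)|move=> <-].
have [dg _ gx] := gu x.
pose w y := invmx (g y) *m derive1n k (fun x => g x *m e1 n) y.
have dw y : derivable w y 1.
  apply: derivable_mulmx; last exact: sg.
  by apply: derivable_invmx_in_O => [z|]; [have [] := gu z|have [] := gu y].
have wE : derive1n k (fun x => g x *m e1 n) = fun y => g y *m w y.
  by apply/funext => y; rewrite mulKVmx.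
rewrite wE derive1_mulmx// gx -mulmxA -mulmxDr mulKmx//.
have w'0 : (k < i)%N -> derive1 w x i 0 = 0.
  move=> ki; have [_ <-] := derivable_derive1 (is_derive_entry i 0 (dw x)).
  rewrite (_ : (fun y => _) = fun=> 0) ?derive1_cst//.
  by apply/funext => y; have [/(_ ki)] := IH y i.
(* D has no entry below the subdiagonal, and w none below row k. *)
have Dw0 (c : 'I_N) : (c.+1 < i)%N || (k < c)%N ->
    (bmx n + Vmx (u x)) i c * w x c 0 = 0.
  case/orP => [ci|kc]; last first.
    by have [/(_ kc)] := IH x c; rewrite -/(w x) => -> _; rewrite mulr0.
  rewrite mxE bmxE Vmx_upper; last exact: ltnW (ltnW ci).
  by rewrite (_ : _ == _ = false) ?addr0 ?mul0r//; lia.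
split=> [ki|ki].
  rewrite mxE w'0 ?addr0; last exact: ltnW.
  by rewrite mxE big1// => c _; apply: Dw0; lia.
have kN : (k < N)%N by ord_lia.
rewrite mxE w'0 ?addr0 -?ki// mxE (bigD1 (Ordinal kN))//= big1 => [|c].
  have [_ /(_ erefl)] := IH x (Ordinal kN); rewrite -/(w x) => ->.
  rewrite mxE bmxE Vmx_upper/=; last by rewrite -ki.
  by rewrite -ki eqxx !addr0 mulr1.
by rewrite -val_eqE/= => ck; apply: Dw0; lia.
Qed.

Lemma frame_system_in_Mcurves g u :
  frame_system g u -> smooth (fun x => g x *m e1 n) ->
  in_Mcurves (fun x => g x *m e1 n).
Proof.
move=> gu sg; have gO x : in_O (g x) by have [] := gu x.
split=> [|x]; last first.
  rewrite (derive1n_frame gu)// form_mulmx_in_O// form_delta mxE.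
  have nN : (n < N)%N by lia.
  rewrite -val_eqE/= inordK// (_ : (_ == _) = true) ?andbT; last by lia.
  by rewrite mulr1 addnn -signr_odd odd_double.
split=> // x; split.
  have -> : jet N (fun x => g x *m e1 n) x = [seq g x *m (invmx (g x) *m
      derive1n k (fun x => g x *m e1 n) x) | k <- iota 0 N].
    by apply: eq_map => k; rewrite mulKVmx// in_O_unit.
  apply: free_unitriangular => //; first exact: in_O_unit.
    by move=> k i; have [] := jet_frame_unitriangular k gu sg x i.
  by move=> i; have [_ ->] := jet_frame_unitriangular i gu sg x i.
rewrite (_ : jet _ _ _ = [seq g x *m delta_mx (inord k) 0 | k <- iota 0 n]).
  exact: maximal_isotropic_frame.
apply/eq_in_map => k; rewrite mem_iota => kn.
by rewrite (derive1n_frame gu)//; lia.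
Qed.

Lemma frame_system_moving_frame g u :
  frame_system g u -> smooth g -> smooth u ->
  moving_frame (fun x => g x *m e1 n) g u.
Proof.
move=> gu sg su; split=> // [x|x i ni|x].
- by have [] := gu x.
- by rewrite (derive1n_frame gu)// colE inord_val.
- have [_ /in_O_unit ug ->] := gu x.
  by rewrite mulKmx// addrC addKr.
Qed.

Lemma moving_frame_system gamma g u :
  moving_frame gamma g u -> frame_system g u.
Proof.
move=> [sg gO _ _ gu] x; split => //; first exact: (sg 0%N).
by rewrite -gu addrC subrK mulKVmx// in_O_unit.
Qed.

Lemma formDl (X Y Z : 'cV[R]_N) : form (X + Y) Z = form X Z + form Y Z.
Proof. by rewrite /form linearD/= !mulmxDl mxE. Qed.

Lemma formZl a (X Z : 'cV[R]_N) : form (a *: X) Z = a * form X Z.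
Proof. by rewrite /form linearZ/= -!scalemxAl mxE. Qed.

Lemma eq_mulmx_cols (A B : 'M[R]_N) (Y : 'cV[R]_N) (m : nat) :
  (forall c : 'I_N, (c <= m)%N ->
     A *m delta_mx c 0 = B *m delta_mx c 0 :> 'cV[R]_N) ->
  (forall c : 'I_N, (m < c)%N -> Y c 0 = 0) -> A *m Y = B *m Y.
Proof.
move=> AB Y0; rewrite (matrix_sum_delta Y) !mulmx_sumr; apply: eq_bigr => c _.
rewrite !big_ord1 -!scalemxAr; have [cm|cm] := leqP c m.
  by congr (_ *: _); exact: AB.
by have -> : Y c ord0 = 0 by [exact: Y0]; rewrite !scale0r.
Qed.

(** The curve gives columns 0, ..., n of both frames g and h. Suppose that they
    share columns 0, ..., n+i and that u and v share their first i coordinates.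
    Differentiating the common column n+i shows that columns n+i+1 differ by
    d times column n-i-1, where d = u_i - v_i. Both columns n+i+1 are null
    vectors, and the form pairs the indices n+i+1 and n-i-1, so 2 d = 0 up to
    sign: column n+i+1 and coordinate i agree as well. *)
Lemma isotropic_curvature_unique gamma g h u v :
  moving_frame gamma g u -> moving_frame gamma h v -> u = v.
Proof.
move=> gfr hfr; have gu := moving_frame_system gfr.
have hv := moving_frame_system hfr.
have [_ gO gcol _ _] := gfr; have [_ hO hcol _ _] := hfr.
suff H i : (i <= n)%N ->
    (forall x (c : 'I_N), (c <= n + i)%N ->
       g x *m delta_mx c 0 = h x *m delta_mx c 0 :> 'cV[R]_N) /\
    (forall x (k : 'I_n), (k < i)%N -> u x 0 k = v x 0 k).
  apply/funext => x; apply/rowP => k.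
  by have [_] := H n (leqnn n); apply.
elim: i => [_|i IH ni].
  by split=> // x c; rewrite addn0 => cn; rewrite -!colE gcol ?hcol.
have [gh uv] := IH (ltnW ni).
have cN : (n + i < N)%N by lia.
have c'N : (n + i.+1 < N)%N by lia.
have rN : (n - i.+1 < N)%N by lia.
pose c := Ordinal cN; pose c' := Ordinal c'N; pose r := Ordinal rN.
pose k := Ordinal ni.
have bc : bmx n *m delta_mx c 0 = delta_mx c' 0 :> 'cV[R]_N.
  rewrite -colE; apply/matrixP => a z; rewrite !mxE bmxE ord1 andbT.
  by rewrite -val_eqE/= addnS.
(* Differentiate the equality of the columns n+i. *)
have hc' x : h x *m delta_mx c' 0
    = g x *m (delta_mx c' 0 + (u x 0 k - v x 0 k) *: delta_mx r 0) :> 'cV[R]_N.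
  have [dg _ gx] := gu x; have [dh _ hx] := hv x.
  have := (derive1_mulmx_cst (delta_mx c 0 : 'cV[R]_N) dg).2.
  rewrite (_ : (fun y => _) = fun y => h y *m delta_mx c 0); last first.
    by apply/funext => y; exact: gh.
  rewrite (derive1_mulmx_cst _ dh).2 gx hx -!mulmxA !mulmxDl !bc !mulmxDr.
  rewrite -(@eq_mulmx_cols (g x) (h x) (Vmx (v x) *m delta_mx c 0) (n + i)).
  - move=> /(canRL (addrK _)) ->; rewrite -addrA; congr (_ + _).
    rewrite -mulmxBr -mulmxBl -VmxB; congr (_ *m _).
    rewrite -colE; apply/matrixP => a z; rewrite ord1 !mxE.
    rewrite (@Vmx_first _ _ _ k)//=.
      by rewrite !mxE andbT -val_eqE/=; congr (_ * _%:R); lia.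
    by move=> l li; rewrite !mxE uv// subrr.
  - by move=> a; exact: gh.
  - by move=> a ca; rewrite -colE mxE Vmx_upper// ltnW.
(* Both columns n+i+1 have the same norm, namely 0. *)
have d0 x : u x 0 k - v x 0 k = 0.
  have := form_mulmx_in_O (delta_mx c' 0) (delta_mx c' 0) (hO x).
  rewrite hc' form_mulmx_in_O// formDl formZl !form_delta !mxE -!val_eqE/=.
  have -> : (n.*2 - (n + i.+1) == n + i.+1)%N = false by lia.
  have -> : (n.*2 - (n + i.+1) == n - i.+1)%N by lia.
  have -> : (n.*2 - (n - i.+1) == n + i.+1)%N by lia.
  have -> : (n.*2 - (n - i.+1) == n - i.+1)%N = false by lia.
  rewrite !andbT/= !mulr0 !add0r addr0 !mulr1.
  rewrite -(signr_odd _ (n + (n - _))) -(signr_odd _ (n + (n + _))).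
  have -> : odd (n + (n - i.+1)) = odd (n + (n + i.+1)) by lia.
  rewrite mulrC -mulrDl -mulr2n => /eqP.
  by rewrite mulf_eq0 signr_eq0 orbF mulrn_eq0 => /eqP.
split=> [x a|x l].
  rewrite addnS leq_eqVlt => /orP[/eqP ac|]; last exact: gh.
  have -> : a = c' by apply: val_inj; rewrite /= addnS.
  by rewrite hc' d0 scale0r addr0.
rewrite ltnS leq_eqVlt => /orP[/eqP li|]; last exact: uv.
have -> : l = k by exact: val_inj.
by apply/eqP; rewrite -subr_eq0 d0.
Qed.

End Frames.

(** * The Cauchy problem for the isotropic curve flows *)

Theorem theorem5p6 (R : realType) (ty : kdv_type) (n j : nat)
  (n_ge1 : (1 <= n)%N) (j_ge1 : (1 <= j)%N)
  (j_mod : ty = Atype -> ~~ (n.*2.+1 %| j.*2.-1)%N)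
  (* P(u, lambda) and eta_j (type B), S(u, lambda) and tilde eta_j (type A) *)
  (Q : @series_operator R n) (Q_def : is_resolvent ty Q)
  (eta : @matrix_operator R n) (eta_def : is_eta j Q eta)
  (* initial curve, its frame and its curvature *)
  (gamma0 : R -> 'cV[R]_(n.*2.+1)) (g0 : R -> 'M[R]_(n.*2.+1))
  (u0 : R -> 'rV[R]_n)
  (gamma0_M : in_Mcurves gamma0)
  (g0_frame : moving_frame gamma0 g0 u0)
  (u0_decay : rapidly_decaying u0)
  (* times of existence *)
  (I : set R) (I_open : open I) (I_itv : is_interval I) (I_0 : I 0)
  (* solution of the KdV flow *)
  (u : R -> R -> 'rV[R]_n)
  (u_sol : kdv_solution (flow_operator j Q eta) I u)
  (u_init : forall x, u x 0 = u0 x)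
  (* solution of the linear system *)
  (g : R -> R -> 'M[R]_(n.*2.+1))
  (g_smooth : smooth_on I g)
  (g_O : forall x t, I t -> in_O (g x t))
  (g_x : forall x t, I t ->
     invmx (g x t) *m dx g x t = bmx n + Vmx (u x t))
  (g_t : forall x t, I t ->
     invmx (g x t) *m dt g x t = flow_operator j Q eta (fun y => u y t) x)
  (g_init : g 0 0 = g0 0) :
  let gamma := fun x t => g x t *m e1 n in
  [/\ curve_flow_solution (flow_operator j Q eta) I gamma g u,
      curve_flow_solution (lambda0_coef j Q) I gamma g u,
      forall x, gamma x 0 = gamma0 x
    & forall t, I t ->
        (exists v, isotropic_curvature (fun x => gamma x t) v) /\
        forall v, isotropic_curvature (fun x => gamma x t) v ->
          rapidly_decaying v].
Proof.
move=> gamma.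
have u_smooth t : I t -> smooth (fun x => u x t).
  by case: u_sol => su _ _; exact: smooth_on_slice.
have gt_smooth t : I t -> smooth (fun x => g x t) by exact: smooth_on_slice.
have gamma_smooth : smooth_on I gamma by exact: smooth_on_mulmxr.
have frame t : I t -> frame_system (fun x => g x t) (fun x => u x t).
  move=> It x; split; [exact: (gt_smooth t It 0%N)|exact: g_O|].
  by rewrite -g_x// mulKVmx// in_O_unit//; exact: g_O.
have mframe t : I t ->
    moving_frame (fun x => gamma x t) (fun x => g x t) (fun x => u x t).
  move=> It; apply: frame_system_moving_frame;
    [exact: frame|exact: gt_smooth|exact: u_smooth].
have Mgamma t : I t -> in_Mcurves (fun x => gamma x t).
  by move=> It; apply: (frame_system_in_Mcurves (frame t It));
    exact: (smooth_on_slice gamma_smooth).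
have gamma_t x t : I t -> dt gamma x t
    = g x t *m flow_operator j Q eta (fun y => u y t) x *m e1 n.
  move=> It; rewrite /dt.
  have [_ [dg _ _]] := g_smooth 1%N; have [_ dgt] := dg x t It.
  rewrite (derive1_mulmx_cst _ dgt).2 -g_t// mulKVmx//.
  by rewrite in_O_unit//; exact: g_O.
split=> //.
- split=> // x t It; rewrite gamma_t// -!mulmxA; congr (_ *m _).
  have [eta_N _] := eta_def.2 _ (u_smooth t It); have [_ etaN] := eta_N x.
  rewrite mulmxBl (_ : eta _ x *m _ = 0) ?subr0//.
  rewrite -colE; apply/matrixP => a z; rewrite !mxE; exact: etaN.
- move=> x; have [_ _ g0col _ _] := g0_frame.
  have g0_sys := moving_frame_system g0_frame.
  have u0E : (fun x => u x 0) = u0 by apply/funext.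
  have g0_eq := frame 0 I_0; rewrite u0E in g0_eq.
  rewrite /gamma (frame_system_unique g0_eq g0_sys g_init x).
  by rewrite /e1 -colE g0col.
- move=> t It; split.
    by exists (fun x => u x t), (fun x => g x t); exact: mframe.
  move=> v [h hfr]; rewrite -(isotropic_curvature_unique (mframe t It) hfr).
  by case: u_sol => _ ud _; exact: ud.
Qed.
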